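(* Every max-plus convex subset $C$ of $E$ has the Kakutani Property: for all disjoint max-plus convex sets $C_1,C_2\subset C$ there exists a max-plus half-space $D$ of $C$ such that $C_1\subset D$ and $C_2\cap D=\emptyset$.
   Context: $E\neq\{0\}$ is an Archimedean Riesz space (real vector lattice; Archimedean means that if $ny\leqslant x$ for all $n\in\mathbb{N}$ then $y\leqslant 0$), and $\mathbf{u}\in E_+$ is a unit: for every $x\in E_+$ there is $n\in\mathbb{N}$ with $x\leqslant n\mathbf{u}$. The max-plus convex hull of a nonempty $S\subset E$ (with respect to $\mathbf{u}$) is the set $[\![S]\!]$ of all elements $(x_1+t_1\mathbf{u})\vee\cdots\vee(x_m+t_m\mathbf{u})$ with $m\ge1$, $x_1,\dots,x_m\in S$, $t_1,\dots,t_m\in\mathbb{R}$ and $\max_i t_i=0$; also $[\![\emptyset]\!]=\emptyset$. A set $C\subset E$ is max-plus convex if $C=[\![C]\!]$. A max-plus half-space of a max-plus convex set $C$ is a max-plus convex set $D\subset C$ such that $C\setminus D$ is also max-plus convex. *)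

(* Defs.v *)
From HB Require Import structures.
From mathcomp Require Import all_boot all_order all_algebra.
From mathcomp Require Import boolp classical_sets reals.

Set Implicit Arguments.
Unset Strict Implicit.
Unset Printing Implicit Defensive.

Import Order.TTheory GRing.Theory Num.Theory.
Local Open Scope classical_set_scope.
Local Open Scope ring_scope.

(* HB rejects a direct join of [GRing.Lmodule] and [Order.Lattice], since the
   already declared [Num.RealDomain] shares their ancestors without passing
   through such a join.  The lattice operations are therefore part of the mixin
   over [Num.POrderedZmodule], and the generic instance below makes every
   [rieszType] a [latticeType] with these operations. *)
HB.mixin Record isRieszSpace (R : realType) E
    of Num.POrderedZmodule E & GRing.Lmodule R E := {
  riesz_meet : E -> E -> E;
  riesz_join : E -> E -> E;
  riesz_meetP : forall x y z : E,
    (x <= riesz_meet y z) = (x <= y) && (x <= z);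
  riesz_joinP : forall x y z : E,
    (riesz_join x y <= z) = (x <= z) && (y <= z);
  riesz_lerD2r : forall z x y : E, x <= y -> x + z <= y + z;
  riesz_scaler_ge0 : forall (a : R) (x : E), 0 <= a -> 0 <= x -> 0 <= a *: x
}.

#[short(type="rieszType")]
HB.structure Definition RieszSpace (R : realType) :=
  {E of isRieszSpace R E & Num.POrderedZmodule E & GRing.Lmodule R E}.

HB.instance Definition _ (R : realType) (E : rieszType R) :=
  @Order.POrder_MeetJoin_isLattice.Build ring_display (RieszSpace.sort E)
    riesz_meet riesz_join riesz_meetP riesz_joinP.

Section MaxPlus.
Context {R : realType} {E : rieszType R}.

Definition archimedean_riesz : Prop :=
  forall x y : E, (forall n : nat, y *+ n <= x) -> y <= 0.

Definition riesz_unit (u : E) : Prop :=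
  0 <= u /\ forall x : E, 0 <= x -> exists n : nat, x <= u *+ n.

(* [E] has no least element and [R] no least real, so the iterated suprema are
   seeded with their own 0-th term, which is harmless by idempotence.  The
   number [m] of points of the definition is [k.+1], so the hull of [set0]
   is [set0]. *)
Definition maxplus_hull (u : E) (S : set E) : set E :=
  [set z | exists (k : nat) (x : 'I_k.+1 -> E) (t : 'I_k.+1 -> R),
    [/\ forall i, S (x i),
        \big[Num.max/t ord0]_i t i = 0 &
        z = \big[Order.join/(x ord0 + t ord0 *: u)]_i (x i + t i *: u)]].

Definition maxplus_convex (u : E) (C : set E) : Prop :=
  C = maxplus_hull u C.

Definition maxplus_halfspace (u : E) (C D : set E) : Prop :=
  [/\ maxplus_convex u D, D `<=` C & maxplus_convex u (C `\` D)].

Definition kakutani_property (u : E) (C : set E) : Prop :=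
  forall C1 C2 : set E,
    maxplus_convex u C1 -> maxplus_convex u C2 ->
    C1 `<=` C -> C2 `<=` C -> C1 `&` C2 = set0 ->
    exists D : set E,
      [/\ maxplus_halfspace u C D, C1 `<=` D & C2 `&` D = set0].

End MaxPlus.

Arguments archimedean_riesz {R} E.

(* Main.v *)
Require Import Defs.
From mathcomp Require Import all_boot all_order all_algebra.
From mathcomp Require Import boolp classical_sets reals.
Import Order.TTheory GRing.Theory Num.Theory.
Local Open Scope classical_set_scope.
Local Open Scope ring_scope.

(** Write [x + a] for [x + a *: u].  A set is max-plus convex iff it is closed
    under binary combinations [(x + a) \/ (y + b)] with [max a b = 0], by
    induction on the number of points ([maxplus_convexP]).

    If [C1] is empty, the empty set is the required half-space.  Otherwise, by
    Zorn's lemma, there is a convex [D] which is maximal among the convex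
    subsets of [C] that contain [C1] and miss [C2] ([maximal_separated]).  If
    [p] is a point of [C] outside [D], then the hull of [D] and [p] is
    strictly larger than [D], so it meets [C2]: there are [d] in [D] and [c]
    in [C2] with [c = (p + a) \/ (d + b)] and [max a b = 0]
    ([maximal_meets_cone]).

    Such a [D] is a half-space.  Otherwise there are [p] and [q] in [C] outside
    [D] and [r = (p + s) \/ (q + t)] in [D] with [max s t = 0].  Take
    [c = (p + a) \/ (d + b)] and [c' = (q + a') \/ (d' + b')] in [C2] as above,
    and choose [g] such that [al = g + s - a] and [be = g + t - a'] have
    maximum 0.  Regrouping the terms in [p] and [q] gives
      [(c + al) \/ (c' + be) = (r + g) \/ (d + b + al) \/ (d' + b' + be)].
    The left side is in [C2].  The coefficients on the right also have
    maximum 0, so the right side is in [D]: this contradicts the disjointness of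
    [D] and [C2].  The unit is used to write [p] itself, and every point [d] of
    [D], in the form [(p + a) \/ (d + b)] with finite coefficients. *)

(** * Joins and translations in a Riesz space *)

Section RieszJoin.
Context {R : realType} {E : rieszType R}.
Implicit Types (x y z u : E) (a b m : R).

Lemma rjoinDr x y z : Order.join x y + z = Order.join (x + z) (y + z).
Proof.
apply/eqP; rewrite eq_le; apply/andP; split.
  rewrite -[leRHS](subrK z); apply: riesz_lerD2r; rewrite leUx.
  by apply/andP; split; rewrite -[leLHS](addrK z); apply: riesz_lerD2r;
    [exact: leUl | exact: leUr].
by rewrite leUx !riesz_lerD2r ?leUl ?leUr.
Qed.

Lemma rjoin_shift x y u a b m :
  Order.join (x + a *: u) (y + b *: u) + m *: u =
  Order.join (x + (a + m) *: u) (y + (b + m) *: u).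
Proof. by rewrite rjoinDr -!addrA -!scalerDl. Qed.

Lemma ler_shift u a b x : 0 <= u -> a <= b -> x + a *: u <= x + b *: u.
Proof.
move=> u0 ab; rewrite ![x + _]addrC; apply: riesz_lerD2r.
rewrite -(subrK a b) scalerDl -[leLHS]add0r; apply: riesz_lerD2r.
by apply: riesz_scaler_ge0; rewrite ?subr_ge0.
Qed.

Lemma rjoin_shift_max u a b x : 0 <= u ->
  Order.join (x + a *: u) (x + b *: u) = x + Num.max a b *: u.
Proof.
move=> u0; case: leP => ab; first by apply: join_r; exact: ler_shift.
by apply: join_l; apply: ler_shift => //; exact: ltW.
Qed.

Lemma unit_dominates u x y : riesz_unit u ->
  exists2 a, a <= 0 & y + a *: u <= x.
Proof.
move=> [_ uP]; have [n hn] := uP (Order.join (y - x) 0) (leUr _ _).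
exists (- n%:R); first by rewrite oppr_le0 ler0n.
have /(riesz_lerD2r (x - u *+ n)) : y - x <= u *+ n.
  by apply: le_trans hn; exact: leUl.
by rewrite addrA subrK addrCA subrr addr0 scaleNr scaler_nat.
Qed.

End RieszJoin.

(** * Binary max-plus combinations *)

Section Closed.
Context {R : realType} {E : rieszType R}.
Implicit Types (x y z u p : E) (a b m : R) (C D : set E).

Definition maxplus_closed u D : Prop :=
  forall x y a b, D x -> D y -> Num.max a b = 0 ->
    D (Order.join (x + a *: u) (y + b *: u)).

(** Combinations whose maximal coefficient [m] is arbitrary reduce to the
    normalised case by subtracting [m *: u]; in this form they can be iterated
    without any normalisation of the intermediate results. *)
Lemma maxplus_closed_level u D x y m n : maxplus_closed u D ->
  D (x - m *: u) -> D (y - n *: u) ->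
  D (Order.join x y - Num.max m n *: u).
Proof.
move=> clD Dx Dy; set M := Num.max m n.
have := clD _ _ (m - M) (n - M) Dx Dy; rewrite -addr_maxl subrr => /(_ erefl).
by rewrite !scalerBl !addrA !subrK -rjoinDr.
Qed.

Lemma maxplus_convexP u D : maxplus_convex u D <-> maxplus_closed u D.
Proof.
split=> [cD x y a b Dx Dy ab|clD].
  rewrite cD; exists 1%N, (fun i => if i == ord0 then x else y),
    (fun i => if i == ord0 then a else b).
  split=> [i||]; first by case: ifP.
  - by rewrite !big_ord_recl big_ord0 /= [Num.max b a]maxC maxA maxxx.
  - by rewrite !big_ord_recl big_ord0 /= [Order.join (y + _) _]joinC joinA joinxx.
apply/seteqP; split=> [x Dx|_ [k [x [t [Dx t0 ->]]]]].
  exists 0%N, (fun=> x), (fun=> 0); split=> //.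
    by rewrite big_ord_recl big_ord0 maxxx.
  by rewrite big_ord_recl big_ord0 joinxx scale0r addr0.
have Dxt i : D (x i + t i *: u - t i *: u) by rewrite addrK.
rewrite -[X in D X]subr0 -(scale0r u) -t0.
apply: (big_ind2 (fun z m => D (z - m *: u))) => // x1 m1 x2 m2.
exact: maxplus_closed_level.
Qed.

(** This is the convex hull of [D] and [p] when [D] is convex and nonempty and
    [u] is a unit. *)
Definition maxplus_cone u p D : set E :=
  [set z | exists d a b, [/\ D d, Num.max a b = 0 &
                             z = Order.join (p + a *: u) (d + b *: u)]].

Lemma maxplus_cone_closed u p D : 0 <= u ->
  maxplus_closed u D -> maxplus_closed u (maxplus_cone u p D).
Proof.
move=> u0 clD _ _ s t [d [a [b [Dd ab ->]]]] [d' [a' [b' [Dd' ab' ->]]]] st.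
set A := Num.max (a + s) (a' + t); set B := Num.max (b + s) (b' + t).
exists (Order.join (d + (b + s) *: u) (d' + (b' + t) *: u) - B *: u), A, B.
split.
- by apply: maxplus_closed_level; rewrite ?addrK.
- by rewrite /A /B maxACA -!addr_maxl ab ab' !add0r.
- by rewrite subrK !rjoin_shift joinACA rjoin_shift_max.
Qed.

Lemma maxplus_cone_sub u p C D : maxplus_closed u C -> C p -> D `<=` C ->
  maxplus_cone u p D `<=` C.
Proof. by move=> clC Cp DC _ [d [a [b [/DC Cd ab ->]]]]; apply: clC. Qed.

Lemma maxplus_cone_base u p D : riesz_unit u -> D `<=` maxplus_cone u p D.
Proof.
move=> uU d Dd; have [a a0 pd] := unit_dominates u d p uU.
exists d, a, 0; split=> //; first exact: max_r.
by rewrite scale0r addr0 join_r.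
Qed.

Lemma maxplus_cone_apex u p D : riesz_unit u -> D !=set0 ->
  maxplus_cone u p D p.
Proof.
move=> uU [d Dd]; have [b b0 dp] := unit_dominates u p d uU.
exists d, 0, b; split=> //; first exact: max_l.
by rewrite scale0r addr0 join_l.
Qed.

End Closed.

(** * Separation *)

Section Separation.
Context {R : realType} {E : rieszType R}.
Implicit Types (u p : E) (C D A B : set E).

Definition separated u C A B D : Prop :=
  [/\ maxplus_closed u D, A `<=` D, D `<=` C & D `&` B = set0].

Lemma maximal_separated u C A B : separated u C A B A ->
  exists2 D, separated u C A B D &
    forall D', separated u C A B D' -> D `<=` D' -> D' `<=` D.
Proof.
move=> sepA.
(* The union of the empty chain is empty and need not contain [A], so the
   order is on the sets [X] for which [A `|` X] is separated. *)
pose P := [set X | separated u C A B (A `|` X)].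
have [|X [PX maxX]] := @Zorn_bigcup _ P.
  move=> F FP Ftot; have [clA _ AC AB] := sepA.
  have P0 : P set0 by rewrite /P /= setU0.
  have common x y : (A `|` \bigcup_(X in F) X) x ->
      (A `|` \bigcup_(X in F) X) y ->
      exists X, [/\ P X, X `<=` \bigcup_(X in F) X, (A `|` X) x & (A `|` X) y].
    have sub X : F X -> X `<=` \bigcup_(X in F) X by move=> FX z Xz; exists X.
    move=> [Ax|[X FX Xx]] [Ay|[Y FY Yy]].
    - by exists set0; split=> //; left.
    - by exists Y; split; [exact: FP | exact: sub | left | right].
    - by exists X; split; [exact: FP | exact: sub | right | left].
    - have [XY|YX] := Ftot X Y FX FY.
        by exists Y; split; [exact: FP | exact: sub | right; exact: XY | right].
      by exists X; split; [exact: FP | exact: sub | right | right; exact: YX].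
  split=> [x y a b Ux Uy ab|x Ax|x Ux|].
  - have [X [[clX _ _ _] XF Xx Xy]] := common x y Ux Uy.
    by have [?|?] := clX _ _ _ _ Xx Xy ab; [left | right; exact: XF].
  - by left.
  - by have [X [[_ _ XC _] _ Xx _]] := common x x Ux Ux; exact: XC.
  - rewrite -subset0 => x [Ux Bx].
    have [X [[_ _ _ XB] _ Xx _]] := common x x Ux Ux.
    by rewrite -XB.
exists (A `|` X) => // D sepD XD x Dx; apply: contrapT => nXx.
have AD : A `|` D = D by apply/setUidPr; case: sepD.
apply: (maxX D); last by rewrite /P /= AD.
split; first by move=> z Xz; apply: XD; right.
by move=> /(_ x Dx) Xx; apply: nXx; right.
Qed.

Lemma maximal_meets_cone u C A B D p : riesz_unit u -> maxplus_closed u C ->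
  A !=set0 -> separated u C A B D ->
  (forall D', separated u C A B D' -> D `<=` D' -> D' `<=` D) ->
  (C `\` D) p -> maxplus_cone u p D `&` B !=set0.
Proof.
move=> uU clC [x Ax] [clD AD DC DB] maxD [Cp nDp].
apply/set0P/eqP => XB; apply: nDp; apply: (maxD (maxplus_cone u p D)).
- split=> //.
  + by apply: maxplus_cone_closed => //; case: uU.
  + by move=> y /AD; apply: maxplus_cone_base.
  + exact: maxplus_cone_sub.
- exact: maxplus_cone_base.
- by apply: maxplus_cone_apex => //; exists x; exact: AD.
Qed.

(** This plays the role of the Pasch axiom.  Shifting the two points of [B] by
    suitable amounts turns their terms in [p] and [q] into a shift of the given
    point of [D], and what is left of them are terms from [D]; so a combination
    of points of [B] is also a combination of points of [D]. *)
Lemma maxplus_pasch u B D p q s t : maxplus_closed u B -> maxplus_closed u D ->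
  maxplus_cone u p D `&` B !=set0 -> maxplus_cone u q D `&` B !=set0 ->
  Num.max s t = 0 -> D (Order.join (p + s *: u) (q + t *: u)) ->
  D `&` B !=set0.
Proof.
move=> clB clD [c [[d [a [b [Dd ab cE]]]] Bc]].
move=> [c' [[d' [a' [b' [Dd' ab' c'E]]]] Bc']] st; set r := Order.join _ _ => Dr.
(* [c + al] and [c' + be] have the same coefficients in [p] and [q] as [r + g];
   the value of [g] makes the combination of [c] and [c'] normalised. *)
pose g := - Num.max (s - a) (t - a').
pose al := s - a + g; pose be := t - a' + g.
have albe : Num.max al be = 0 by rewrite /al /be -addr_maxl subrr.
have ala : a + al = s + g by rewrite /al addrA addrCA subrr addr0.
have bea : a' + be = t + g by rewrite /be addrA addrCA subrr addr0.
exists (Order.join (c + al *: u) (c' + be *: u)); split; last exact: clB.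
have -> : Order.join (c + al *: u) (c' + be *: u) =
    Order.join (r + g *: u)
      (Order.join (d + (b + al) *: u) (d' + (b' + be) *: u)).
  by rewrite cE c'E /r !rjoin_shift ala bea joinACA.
have max0 : Num.max g (Num.max (b + al) (b' + be)) = 0.
  have -> : g = Num.max (a + al) (a' + be).
    by rewrite ala bea -addr_maxl st add0r.
  by rewrite maxACA -!addr_maxl ab ab' !add0r.
rewrite -[X in D X]subr0 -(scale0r u) -max0.
by do 2?[apply: maxplus_closed_level => //]; rewrite addrK.
Qed.

Lemma maximal_halfspace u C A B D : riesz_unit u -> maxplus_closed u C ->
  maxplus_closed u B -> A !=set0 -> separated u C A B D ->
  (forall D', separated u C A B D' -> D `<=` D' -> D' `<=` D) ->
  maxplus_halfspace u C D.
Proof.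
move=> uU clC clB A0 sepD maxD; have [clD _ DC DB] := sepD.
split=> //; apply/maxplus_convexP => // p q s t Cp Cq st; split.
  by apply: clC => //; [case: Cp | case: Cq].
move=> Dr; suff : D `&` B !=set0 by rewrite DB => -[].
by apply: (maxplus_pasch _ _ _ _ _ _ _ clB clD _ _ st Dr);
  apply: maximal_meets_cone maxD _.
Qed.

End Separation.

Theorem lemma10 (R : realType) (E : rieszType R)
  (E_neq0 : exists x : E, x != 0)
  (E_archi : archimedean_riesz E)
  (u : E) (u_unit : riesz_unit u)
  (C : set E) (C_convex : maxplus_convex u C) :
  kakutani_property u C.
Proof.
move=> C1 C2 cC1 cC2 C1C C2C C12.
have [C1_0|/set0P C1_n0] := eqVneq C1 set0.
  (* The cone over an empty set does not contain its apex, so the maximality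
     argument needs a point in [C1]. *)
  exists set0; split; rewrite ?C1_0 ?setI0 //.
  by split; rewrite ?setD0 // -C1_0.
have sepC1 : separated u C C1 C2 C1 by split=> //; exact/maxplus_convexP.
have [D sepD maxD] := maximal_separated _ _ _ _ sepC1.
have [_ C1D _ DC2] := sepD.
exists D; split=> //; last by rewrite setIC.
by apply: maximal_halfspace C1_n0 sepD maxD => //; exact/maxplus_convexP.
Qed.
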